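(* Let $r \in U(60)$ with $r \equiv 1 \pmod 4$, and let $k \in \{0,1,\ldots,59\}$. Then the subsequence $(\mathcal{F}_{10,k+rj})_{j=0}^\infty$ is a forward complete Fibonacci subsequence. That is: (i) for all $j \in \mathbb{Z}$, $\mathcal{F}_{10,k+r(j-1)} + \mathcal{F}_{10,k+rj} \equiv \mathcal{F}_{10,k+r(j+1)} \pmod{10}$; (ii) its diagram is of Type 3; and (iii) there exists $N_{k,r} \in \{0,1,\ldots,59\}$ such that $\mathcal{F}_{10,k+rj} = \mathcal{F}_{10,N_{k,r}+j}$ for all integers $j \geq 0$.
   Context: The Fibonacci numbers are $F_0=0$, $F_1=1$, $F_n=F_{n-1}+F_{n-2}$, extended to all $n\in\mathbb{Z}$ by the same recurrence. For $n \in \mathbb{Z}$, $\mathcal{F}_{10,n} \in \{0,1,\ldots,9\}$ is the least nonnegative residue of $F_n$ modulo $10$; the sequence $(\mathcal{F}_{10,n})$ is periodic with period $60$. $U(60)=\{1\le r\le 59 : \gcd(r,60)=1\}$ is the multiplicative group of units modulo $60$. The diagram of $(\mathcal{F}_{10,k+rj})_{j=0}^\infty$ is obtained by placing 60 points, indexed by residues modulo $60$, on a circle and joining successive points indexed by $k+rj \bmod 60$; it is of Type 3 when $\gcd(r,60)=1$ (so all 60 points are vertices). The subsequence is forward quasi-Fibonacci if (i) holds, and a forward complete Fibonacci subsequence if it is forward quasi-Fibonacci with a Type 3 diagram, in which case it coincides with $(\mathcal{F}_{10,n})_{n=N_{k,r}}^\infty$ for some $N_{k,r} \in \{0,\ldots,59\}$;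 all of this is included in the claim. *)

(* Defs.v *)
From mathcomp Require Import all_boot all_order all_algebra.
From mathcomp Require Import ring.

Set Implicit Arguments.
Unset Strict Implicit.
Unset Printing Implicit Defensive.

Import GRing.Theory.

Local Open Scope ring_scope.

(* Pairs (F_n, F_(n+1)); fib_fwd goes from n to n + 1, and fib_bwd from n to
   n - 1, solving the recurrence for its lowest-index term. *)
Definition fib_fwd (p : int * int) : int * int := (p.2, p.1 + p.2).
Definition fib_bwd (p : int * int) : int * int := (p.2 - p.1, p.1).

Definition fib (n : int) : int :=
  match n with
  | Posz m => (iter m fib_fwd (0, 1)).1
  | Negz m => (iter m.+1 fib_bwd (0, 1)).1
  end.

Lemma fib0 : fib 0 = 0. Proof. by []. Qed.

Lemma fib1 : fib 1 = 1. Proof. by []. Qed.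

Lemma fib_rec (n : int) : fib n = fib (n - 1) + fib (n - 2).
Proof.
case: n => [[|[|n]]|n] //.
- have -> : n.+2%:Z - 1 = n.+1%:Z by rewrite !intS; ring.
  have -> : n.+2%:Z - 2 = n%:Z by rewrite !intS; ring.
  by rewrite /fib !iterS /= addrC.
- have -> : Negz n - 1 = Negz n.+1 by rewrite !NegzE !intS; ring.
  have -> : Negz n - 2 = Negz n.+2 by rewrite !NegzE !intS; ring.
  by rewrite /fib !iterS /=; ring.
Qed.

Definition fib10 (n : int) : int := (fib n %% 10)%Z.

Definition U (n : nat) : pred nat :=
  [pred r | (1 <= r <= n.-1)%N && coprime r n].

Definition forward_quasi_fibonacci (k r : nat) : Prop :=
  forall j : int,
    (fib10 (k%:Z + r%:Z * (j - 1)) + fib10 (k%:Z + r%:Z * j)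
       = fib10 (k%:Z + r%:Z * (j + 1)) %[mod 10])%Z.

(* The points of the circle are the elements of 'Z_60. *)
Definition diagram_point (k r j : nat) : 'Z_60 := (k + r * j)%N%:R.

Definition diagram_edge (k r : nat) (p q : 'Z_60) : Prop :=
  exists j : nat,
    (p = diagram_point k r j /\ q = diagram_point k r j.+1) \/
    (q = diagram_point k r j /\ p = diagram_point k r j.+1).

Definition diagram_vertex (k r : nat) (p : 'Z_60) : Prop :=
  exists q : 'Z_60, diagram_edge k r p q.

(* The second clause follows from the first; it is kept so that Type 3 says
   something about the diagram itself and not only about the step r. *)
Definition type3_diagram (k r : nat) : Prop :=
  coprime r 60 /\ (forall p : 'Z_60, diagram_vertex k r p).

Definition forward_complete_fibonacci (k r : nat) : Prop :=
  forward_quasi_fibonacci k r /\ type3_diagram k r.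

(* Main.v *)
Require Import Defs.
From mathcomp Require Import all_boot all_order all_algebra.
From mathcomp Require Import ring zify.

(** Modulo 10 one has F_15 = 0 and F_14 = 7, so F_(n+15) = 7 F_n, and 7^4 = 1
    makes 60 a period.  Both the relation F_(m-r) + F_m = F_(m+r) (an instance
    of F_(m+r) = L_r F_m + F_(m-r) for odd r, where the Lucas number L_r is 1
    modulo 10) and the existence of N with F_N = F_k, F_(N+1) = F_(k+r) are
    therefore finite checks on residues modulo 60.  A Fibonacci-type sequence
    is determined by its first two terms, which gives the shifted sequence. *)

Import GRing.Theory.

Local Open Scope ring_scope.

Lemma fib_add2 (n : int) : fib (n + 2) = fib (n + 1) + fib n.
Proof. by rewrite [LHS]fib_rec; congr (fib _ + fib _); ring. Qed.

(** Both sides satisfy the Fibonacci recurrence in [m], so the induction carries two consecutive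
    instances. Only [m] is natural; [n] may be negative. *)
Lemma fib_addS (n : int) (m : nat) :
  fib (n + m.+1%:Z) = fib m.+1%:Z * fib (n + 1) + fib m%:Z * fib n.
Proof.
suff: fib (n + m.+1%:Z) = fib m.+1%:Z * fib (n + 1) + fib m%:Z * fib n /\
      fib (n + m.+2%:Z) = fib m.+2%:Z * fib (n + 1) + fib m.+1%:Z * fib n.
  by case.
have addS2 (p : int) (i : nat) :
  fib (p + i.+2%:Z) = fib (p + i.+1%:Z) + fib (p + i%:Z).
  have -> : p + i.+2%:Z = p + i%:Z + 2 by lia.
  by rewrite fib_add2; congr (fib _ + fib _); lia.
have fibS2 (i : nat) : fib i.+2%:Z = fib i.+1%:Z + fib i%:Z.
  by have := addS2 0 i; rewrite !add0r.
elim: m => [|m [IH1 IH2]].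
  by rewrite addS2 addr0 fibS2 fib0 fib1; split; ring.
by split=> //; rewrite addS2 IH1 IH2 (fibS2 m.+1) (fibS2 m); ring.
Qed.

Lemma fib_add15 (n : int) : (fib (n + 15) = 7 * fib n %[mod 10])%Z.
Proof.
rewrite (fib_addS n 14).
have -> : fib 15%:Z = 610 by vm_compute.
have -> : fib 14%:Z = 377 by vm_compute.
by lia.
Qed.

Lemma fib10_add60 (n : int) : fib10 (n + 60) = fib10 n.
Proof.
rewrite /fib10.
have -> : n + 60 = n + 15 + 15 + 15 + 15 by ring.
have := fib_add15 n; have := fib_add15 (n + 15).
have := fib_add15 (n + 15 + 15); have := fib_add15 (n + 15 + 15 + 15).
by lia.
Qed.

Lemma fib10_periodic (m n : int) : (m = n %[mod 60])%Z -> fib10 m = fib10 n.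
Proof.
have addM (p : int) (i : nat) : fib10 (p + i%:Z * 60) = fib10 p.
  elim: i => [|i IH]; first by rewrite mul0r addr0.
  by rewrite -[RHS]IH -[RHS]fib10_add60; congr fib10; lia.
have red (p : int) : fib10 p = fib10 (p %% 60)%Z.
  rewrite {1}(divz_eq p 60) addrC; case: (p %/ 60)%Z => i; first exact: addM.
  (* The quotient [Negz i] is -(i+1), so adding [i.+1] periods leads back to the residue. *)
  by rewrite -[LHS](addM _ i.+1); congr fib10; lia.
by move=> emn; rewrite (red m) (red n) emn.
Qed.

(* Reducing at every step keeps the unary numbers small enough to evaluate. *)
Definition fib10_nat (n : nat) : nat :=
  (iter n (fun p => (p.2, (p.1 + p.2) %% 10)) (0, 1)).1%N.

Lemma fib10_natE (n : nat) : fib10 n%:Z = (fib10_nat n)%:Z.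
Proof.
rewrite /fib10 /fib /fib10_nat.
suff [] : ((iter n fib_fwd (0, 1)).1 %% 10)%Z
    = ((iter n (fun p => (p.2, (p.1 + p.2) %% 10)) (0, 1)).1%N)%:Z /\
  ((iter n fib_fwd (0, 1)).2 %% 10)%Z
    = ((iter n (fun p => (p.2, (p.1 + p.2) %% 10)) (0, 1)).2%N)%:Z by [].
elim: n => //= n.
case: (iter n fib_fwd _) => a b; case: (iter n _ _) => c d /= [ea eb].
by split; lia.
Qed.

(** Leaves eight steps [r] for the finite checks below. *)
Lemma U60_mod4_cases (r : nat) : r \in U 60 -> (r = 1 %[mod 4])%N ->
  r \in [:: 1; 13; 17; 29; 37; 41; 49; 53]%N.
Proof.
move=> rU r1.
have r60 : (r < 60)%N by case/andP: rU => /andP[].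
have : all (fun s => (s \in U 60) && (s == 1 %[mod 4])%N ==>
    (s \in [:: 1; 13; 17; 29; 37; 41; 49; 53]%N)) (iota 0 60) by vm_compute.
by move/allP/(_ r); rewrite mem_iota rU r1 eqxx; apply.
Qed.

Lemma fib10_step (r : nat) (n : int) : r \in U 60 -> (r = 1 %[mod 4])%N ->
  (fib10 (n - r%:Z) + fib10 n = fib10 (n + r%:Z) %[mod 10])%Z.
Proof.
move=> rU r1; have rs := U60_mod4_cases r rU r1.
have r60 : (r < 60)%N by case/andP: rU => /andP[].
pose m := `|(n %% 60)%Z|%N.
have m60 : (m < 60)%N by rewrite /m; lia.
(* Adding a period turns n - r into a natural index; the truncated subtraction is exact because r <
   60. *)
rewrite (fib10_periodic (n - r%:Z) (m + (60 - r))%N%:Z); last by rewrite /m; lia.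
rewrite (fib10_periodic (n + r%:Z) (m + r)%N%:Z); last by rewrite /m; lia.
rewrite (fib10_periodic n m%:Z); last by rewrite /m; lia.
rewrite !fib10_natE.
have : all (fun s => all (fun i =>
    fib10_nat (i + (60 - s)) + fib10_nat i == fib10_nat (i + s) %[mod 10])%N
    (iota 0 60)) [:: 1; 13; 17; 29; 37; 41; 49; 53]%N by vm_compute.
move=> /allP/(_ r rs)/allP/(_ m); rewrite mem_iota => /(_ m60)/eqP.
by lia.
Qed.

(** The 60 pairs of consecutive Fibonacci residues cannot exhaust the 100 pairs modulo 10, so it
    needs checking that (F_k, F_(k+r)) is one of them; a search over [N] does this. *)
Lemma fib10_initial_terms (k r : nat) :
  (k < 60)%N -> r \in U 60 -> (r = 1 %[mod 4])%N ->
  exists N : nat, [/\ (N < 60)%N, fib10 k%:Z = fib10 N%:Z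
    & fib10 (k + r)%N%:Z = fib10 N.+1%:Z].
Proof.
move=> k60 rU r1; have rs := U60_mod4_cases r rU r1.
have : all (fun s => all (fun i => has (fun N =>
    (fib10_nat i == fib10_nat N) && (fib10_nat (i + s) == fib10_nat N.+1))%N
    (iota 0 60)) (iota 0 60)) [:: 1; 13; 17; 29; 37; 41; 49; 53]%N.
  by vm_compute.
move=> /allP/(_ r rs)/allP/(_ k); rewrite mem_iota => /(_ k60)/hasP[N].
rewrite mem_iota => N60 /andP[/eqP e0 /eqP e1].
by exists N; rewrite !fib10_natE e0 e1.
Qed.

Lemma forward_quasi_fibonacci_U60 (k r : nat) :
  r \in U 60 -> (r = 1 %[mod 4])%N -> forward_quasi_fibonacci k r.
Proof.
move=> rU r1 j; have := fib10_step r (k%:Z + r%:Z * j) rU r1.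
have -> : k%:Z + r%:Z * j - r%:Z = k%:Z + r%:Z * (j - 1) by ring.
by have -> : k%:Z + r%:Z * j + r%:Z = k%:Z + r%:Z * (j + 1) by ring.
Qed.

(** As r is invertible modulo 60, k + r j = p has the solution j = (p - k)/r, so [p] is joined to
    the point after it. *)
Lemma type3_diagram_coprime (k r : nat) : coprime r 60 -> type3_diagram k r.
Proof.
move=> cr; split=> // p.
have ru : (r%:R : 'Z_60) \is a GRing.unit by rewrite unitZpE // coprime_sym.
pose j : 'Z_60 := r%:R^-1 * (p - k%:R).
exists (diagram_point k r (nat_of_ord j).+1), (nat_of_ord j); left; split=> //.
by rewrite /diagram_point natrD natrM natr_Zp mulVKr // addrC subrK.
Qed.

Lemma forward_quasi_fibonacci_shift (k r N : nat) :
  forward_quasi_fibonacci k r ->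
  fib10 k%:Z = fib10 N%:Z -> fib10 (k + r)%N%:Z = fib10 N.+1%:Z ->
  forall j : nat, fib10 (k%:Z + r%:Z * j%:Z) = fib10 (N%:Z + j%:Z).
Proof.
move=> qf e0 e1 j.
suff [] : fib10 (k%:Z + r%:Z * j%:Z) = fib10 (N%:Z + j%:Z) /\
  fib10 (k%:Z + r%:Z * j.+1%:Z) = fib10 (N%:Z + j.+1%:Z) by [].
elim: j => [|j [IH1 IH2]].
  by rewrite mulr0 !addr0 mulr1 -!PoszD addn1.
split=> //.
(* Centred at j+1, the relation gives the term at j+2 from the two known ones. *)
have := qf j.+1%:Z.
have -> : j.+1%:Z - 1 = j%:Z by lia.
have -> : j.+1%:Z + 1 = j.+2%:Z by lia.
rewrite IH1 IH2.
have := fib_add2 (N%:Z + j%:Z).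
have -> : N%:Z + j%:Z + 2 = N%:Z + j.+2%:Z by lia.
have -> : N%:Z + j%:Z + 1 = N%:Z + j.+1%:Z by lia.
(* Values of [fib10] are reduced residues, so congruence modulo 10 gives equality. *)
by rewrite /fib10; lia.
Qed.

Theorem theorem5p10 (k r : nat) (hk : (k < 60)%N) (hr : r \in U 60)
    (hr4 : (r = 1 %[mod 4])%N) :
  forward_complete_fibonacci k r /\
  (exists N : nat, (N < 60)%N /\
     forall j : nat, fib10 (k%:Z + r%:Z * j%:Z) = fib10 (N%:Z + j%:Z)).
Proof.
have qf := forward_quasi_fibonacci_U60 k r hr hr4.
split.
  by split=> //; apply: type3_diagram_coprime; case/andP: hr.
have [N [N60 e0 e1]] := fib10_initial_terms k r hk hr hr4.
by exists N; split=> //; apply: (forward_quasi_fibonacci_shift k r N).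
Qed.
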